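(* Let $d\ge1$ be an integer and let $X \sim \mathbb{P}_X$ where $\mathbb{P}_X$ is supported on $[0,1]^d$. Then, for all $K, \beta > 0$, there exist $L, \sigma > 0$ such that $$\inf_{\widehat F} \ \sup_{F_{Y|X} \in \mathcal{D}(K, \beta)} \mathbb{E}\bigg[\int_{\mathbb{R}} \big|F_{Y|X}(t|X) - \widehat F(t|X)\big|\, dt\bigg] \geq \inf_{\widehat f} \ \sup_{f_0 \in \mathcal{H}(L, \beta)} \mathbb{E}\Big[\|\widehat f - f_0\|_{L^1(\mathbb{P}_X)}\Big],$$ where both infima are taken over all estimators based on an i.i.d. sample $S_n=\{(X_1,Y_1),\dots,(X_n,Y_n)\}$ with $X_i\sim\mathbb{P}_X$; on the left-hand side $Y_i$ given $X_i=x$ has cdf $F_{Y|X}(\cdot|x)$, and on the right-hand side the data follow the regression model $Y_i = f_0(X_i) + \varepsilon_i$ with $\varepsilon_i\sim\mathcal{N}(0,\sigma^2)$ independent of $X_i$.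
   Context: $F_{Y|X}(t|x)=\mathbb{P}\{Y\le t\mid X=x\}$ denotes the conditional cdf of a real-valued $Y$ (with atomless distribution) given $X$. On the left-hand side, $X\sim\mathbb{P}_X$ is independent of $S_n$ and the expectation is over $S_n$ and $X$; on the right-hand side the expectation is over $S_n$. An estimator $\widehat F(t|x)$ (resp. $\widehat f(x)$) is a measurable function of $(t,x)$ (resp. $x$) and of the sample. $\|g\|_{L^1(\mathbb{P}_X)}=\int|g|\,d\mathbb{P}_X$. Notation. $\|x\|=\max_i|x_i|$ on $\mathbb{R}^d$; $\|f\|_\infty$ is the sup-norm of a function. For a multi-index $\alpha\in\{0,1,2,\dots\}^d$: $|\alpha|=\sum_i\alpha_i$, $\partial^\alpha=\prod_j\partial_j^{\alpha_j}$; derivatives $\partial^\alpha F(t|x)$ are taken with respect to $x$ for fixed $t$. Every $\beta>0$ is written $\beta=\ell+\gamma$ with $\ell\ge0$ an integer and $\gamma\in(0,1]$. Smoothness classes. $\mathcal{D}(K,\beta)$ is the class of conditional cdfs $F_{Y|X}$ such that (i) for any $t$, the partial derivatives $\partial^\alpha F_{Y|X}(t|x)$ exist for all $|\alpha|\le\ell$; and (ii) for any $|\alpha|=\ell$ and any $x,y\in[0,1]^d$, $\int_{\mathbb{R}}|\partial^\alpha F_{Y|X}(t|x)-\partial^\alpha F_{Y|X}(t|y)|\,dt\le K\|x-y\|^\gamma$. The Hölder class is $$\mathcal{H}(L,\beta):=\Big\{f:\mathbb{R}^d\to\mathbb{R}:\ \sum_{0\le|\alpha|\le\ell-1}\|\partial^\alpha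 f\|_\infty+\sup_{|\alpha|=\ell,\ x\ne y}\frac{|\partial^\alpha f(x)-\partial^\alpha f(y)|}{\|x-y\|^\gamma}\le L\Big\}.$$ *)

(* Defs.v *)
From HB Require Import structures.
From mathcomp Require Import all_boot all_order all_algebra.
From mathcomp Require Import all_classical all_reals all_analysis.

Set Implicit Arguments.
Unset Strict Implicit.
Unset Printing Implicit Defensive.

Import Order.TTheory GRing.Theory Num.Theory.
Import numFieldNormedType.Exports.

Local Open Scope classical_set_scope.
Local Open Scope ring_scope.

(* R^d is 'rV[R]_d; its norm in the library is the sup-norm max_i |x_i|.      *)
(* It is equipped here with its Borel sigma-algebra.                          *)
HB.instance Definition _ (R : realType) (d : nat) :=
  isMeasurable.Build (sigma_display (@open 'rV[R]_d)) 'rV[R]_d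
    (@sigma_algebra0 _ setT (@open 'rV[R]_d))
    (@sigma_algebraC _ (@open 'rV[R]_d))
    (@sigma_algebra_bigcup _ setT (@open 'rV[R]_d)).

Section multi_index_derivatives.
Context {R : realType} {d : nat}.
Implicit Types (f : 'rV[R]_d -> R) (a : {ffun 'I_d -> nat}).

Definition mi_deg a : nat := \sum_j a j.

(* The nondecreasing word in which each j occurs a j times: the partial       *)
(* derivatives in the product prod_j partial_j ^ (a j) are composed in the    *)
(* order in which this product is written, the last coordinate innermost.     *)
Definition mi_word a : seq 'I_d := flatten [seq nseq (a j) j | j <- enum 'I_d].

Definition partial (j : 'I_d) f : 'rV[R]_d -> R :=
  fun x => 'D_(delta_mx ord0 j) f x.

Definition partial_word (w : seq 'I_d) f : 'rV[R]_d -> R := foldr partial f w.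

(* 'D_v is total, so the existence of each successive partial derivative, at  *)
(* every point of R^d, has to be required separately.                         *)
Fixpoint has_partial_word (w : seq 'I_d) f : Prop :=
  if w is j :: v then
    has_partial_word v f /\
    forall x, derivable (partial_word v f) x (delta_mx ord0 j)
  else True.

Definition mi_partial a f : 'rV[R]_d -> R := partial_word (mi_word a) f.

Definition has_mi_partial a f : Prop := has_partial_word (mi_word a) f.

End multi_index_derivatives.

Section smoothness_index.
Context {R : realType}.

(* beta = smooth_int beta + smooth_frac beta, see smooth_decomp *)
Definition smooth_int (beta : R) : nat := `|Num.ceil beta|%N.-1.

Definition smooth_frac (beta : R) : R := beta - (smooth_int beta)%:R.

Lemma smooth_decomp (beta : R) : 0 < beta ->
  beta = (smooth_int beta)%:R + smooth_frac beta /\ 0 < smooth_frac beta <= 1.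
Proof.
move=> b0; split; first by rewrite /smooth_frac addrC subrK.
have c0 : (0 < Num.ceil beta)%R by rewrite ceil_gt0.
have /andP[cb bc] := ceil_itv beta.
have cE : (smooth_int beta)%:R = (Num.ceil beta - 1)%:~R :> R.
  rewrite /smooth_int; case: (Num.ceil beta) c0 => [[//|m]|//] _.
  by rewrite intS addrAC subrr add0r.
by rewrite /smooth_frac subr_gt0 lerBlDl cE cb -[1%R]/(1%:~R) -intrD subrK bc.
Qed.

End smoothness_index.

Section hoelder_class.
Context {R : realType} {d : nat}.
Local Open Scope ereal_scope.
Implicit Type f : 'rV[R]_d -> R.

Definition sup_norm f : \bar R := ereal_sup (range (fun x => `|f x|%:E)).

Definition hoelder_seminorm (l : nat) (g : R) f : \bar R :=
  ereal_sup [set q | exists (a : {ffun 'I_d -> nat}) (x y : 'rV[R]_d),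
    [/\ mi_deg a = l, x <> y &
      q = (`|mi_partial a f x - mi_partial a f y| / `|x - y| `^ g)%R%:E]].

Definition hoelder_class (L beta : R) : set ('rV[R]_d -> R) :=
  [set f |
    (forall a, (mi_deg a <= smooth_int beta)%N -> has_mi_partial a f) /\
    (\esum_(a in [set a | (mi_deg a < smooth_int beta)%N])
        sup_norm (mi_partial a f))
      + hoelder_seminorm (smooth_int beta) (smooth_frac beta) f <= L%:E].

End hoelder_class.

Section joint_law.
Context d1 d2 (T1 : measurableType d1) (T2 : measurableType d2) (R : realType).
Local Open Scope ereal_scope.
Variables (P : probability T1 R) (k : R.-pker T1 ~> T2).

(* Law of (X, Y) when X ~ P and Y given X = x has law k x. *)
Definition joint_law : set (T1 * T2) -> \bar R :=
  fun A => \int[P]_x k x (xsection A x).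

Let joint0 : joint_law set0 = 0.
Proof. by apply: integral0_eq => x _; rewrite xsection0 measure0. Qed.

Let joint_ge0 A : 0 <= joint_law A.
Proof. exact: integral_ge0. Qed.

Let joint_sigma_additive : semi_sigma_additive joint_law.
Proof.
move=> F mF tF mUF; have -> : joint_law (\bigcup_n F n) =
    \sum_(n <oo) joint_law (F n).
  rewrite /joint_law -integral_nneseries //; last first.
    by move=> n; apply: measurable_fun_xsection_finite_kernel; rewrite inE.
  apply: eq_integral => x _; rewrite xsection_bigcup.
  apply: measure_semi_bigcup => //.
  - by move=> n; exact: measurable_xsection.
  - exact: trivIset_xsection.
  - by apply: bigcupT_measurable => n; exact: measurable_xsection.
by apply: is_cvg_nneseries => n _ _; exact: joint_ge0.
Qed.

HB.instance Definition _ := isMeasure.Build _ _ _ joint_law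
  joint0 joint_ge0 joint_sigma_additive.

Let joint_setT : joint_law setT = 1.
Proof.
rewrite /joint_law; under eq_integral do rewrite xsectionE preimage_setT prob_kernel.
by rewrite integral_cst// mul1e; exact: probability_setT.
Qed.

HB.instance Definition _ := Measure_isProbability.Build _ _ _ joint_law joint_setT.

End joint_law.

Section iid_law.
Context dd (T : measurableType dd) (R : realType).

Definition tuple_cons n (p : T * n.-tuple T) : n.+1.-tuple T :=
  [tuple of p.1 :: p.2].

Lemma measurable_tuple_cons n : measurable_fun [set: T * n.-tuple T]
  (@tuple_cons n).
Proof. by apply: measurable_cons. Qed.

HB.instance Definition _ n := isMeasurableFun.Build _ _ _ _ (@tuple_cons n)
  (@measurable_tuple_cons n).

(* The n-fold product measure Q x ... x Q. *)
Fixpoint iid_law (Q : probability T R) (n : nat) : probability (n.-tuple T) R :=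
  if n is m.+1 then distribution (Q \x iid_law Q m)%E (@tuple_cons m)
  else \d_([tuple] : 0.-tuple T).

End iid_law.

Section conditional_cdf.
Context {R : realType} {d : nat}.
Local Open Scope ereal_scope.
Implicit Type k : R.-pker 'rV[R]_d ~> R.

(* F_{Y|X}(t|x), where k x is the conditional law of Y given X = x. *)
Definition cond_cdf k (t : R) (x : 'rV[R]_d) : R := fine (k x `]-oo, t]%classic).

Definition unit_cube : set 'rV[R]_d :=
  [set x | forall j, (0 <= x ord0 j <= 1)%R].

(* The class D(K, beta). A conditional cdf is represented by the              *)
(* corresponding probability kernel; PX only matters for the first            *)
(* requirement, namely that Y has an atomless (marginal) distribution.        *)
Definition cdf_class (PX : probability 'rV[R]_d R) (K beta : R) :
    set (R.-pker 'rV[R]_d ~> R) :=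
  [set k |
    [/\ forall t, joint_law PX k ([set: 'rV[R]_d] `*` [set t]) = 0,
        forall t a, (mi_deg a <= smooth_int beta)%N ->
          has_mi_partial a (cond_cdf k t) &
        forall a, mi_deg a = smooth_int beta ->
          forall x y, unit_cube x -> unit_cube y ->
          \int[lebesgue_measure]_t
              (`|mi_partial a (cond_cdf k t) x
                 - mi_partial a (cond_cdf k t) y|)%:E
            <= (K * `|x - y| `^ smooth_frac beta)%:E]].

End conditional_cdf.

Section minimax.
Context {R : realType} {d : nat}.
Local Open Scope ereal_scope.
Variables (PX : probability 'rV[R]_d R) (n : nat).

Let sample := n.-tuple ('rV[R]_d * R).

Definition cdf_estimator : set (sample -> R -> 'rV[R]_d -> R) :=
  [set Fh | measurable_fun setT
    (fun w : sample * (R * 'rV[R]_d) => Fh w.1 w.2.1 w.2.2)].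

Definition reg_estimator : set (sample -> 'rV[R]_d -> R) :=
  [set fh | measurable_fun setT (fun w : sample * 'rV[R]_d => fh w.1 w.2)].

(* Expectation over S_n and over an independent X. *)
Definition cdf_risk (Fh : sample -> R -> 'rV[R]_d -> R)
    (k : R.-pker 'rV[R]_d ~> R) : \bar R :=
  \int[iid_law (joint_law PX k) n \x PX]_w
    \int[lebesgue_measure]_t (`|cond_cdf k t w.2 - Fh w.1 t w.2|)%:E.

(* The sample (X_i, f0 X_i + eps_i)_i as a function of (X_i, eps_i)_i. *)
Definition reg_sample (f0 : 'rV[R]_d -> R) (s : sample) : sample :=
  [tuple of map (fun p => (p.1, f0 p.1 + p.2)%R) s].

Definition reg_risk (sigma : R) (fh : sample -> 'rV[R]_d -> R)
    (f0 : 'rV[R]_d -> R) : \bar R :=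
  \int[iid_law (PX \x normal_prob 0%R sigma) n]_s
    \int[PX]_x (`|fh (reg_sample f0 s) x - f0 x|)%:E.

Definition minimax_cdf (K beta : R) : \bar R :=
  ereal_inf [set ereal_sup [set cdf_risk Fh k | k in cdf_class PX K beta]
            | Fh in cdf_estimator].

Definition minimax_reg (L beta sigma : R) : \bar R :=
  ereal_inf [set ereal_sup [set reg_risk sigma fh f0 | f0 in hoelder_class L beta]
            | fh in reg_estimator].

End minimax.

(* Main.v *)
From HB Require Import structures.
Require Import Defs.
From mathcomp Require Import all_boot all_order all_algebra.
From mathcomp Require Import all_classical all_reals all_analysis.
From mathcomp Require Import measurable_realfun.
From mathcomp Require Import ring lra.
Import numFieldNormedType.Exports.

(* Take sigma = 1 and L small. A regression function f0 in H(L, beta) gives   *)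
(* the location family F(t|x) = Phi(t - f0 x), where Phi is the standard      *)
(* normal cdf, and the sample of the regression model has the law of a sample *)
(* from F.                                                                    *)
(*                                                                            *)
(* From an estimator Fhat of F build fhat x = int (Phi t - Fhat(t|x)) dt.     *)
(* Since int (Phi t - Phi(t - a)) dt = a, one gets                            *)
(* |fhat x - f0 x| <= int |F(t|x) - Fhat(t|x)| dt, so the risks compare with  *)
(* constant 1.                                                                *)
(*                                                                            *)
(* F lies in D(K, beta): by the Faa di Bruno formula a derivative of order l  *)
(* of F is a sum of terms Phi^(k)(t - f0 x) * prod_B d^B f0 x, the functions  *)
(* Phi^(k) are Lipschitz with an integrable Gaussian envelope, and the d^B f0 *)
(* are bounded and Hoelder with constants proportional to L. The Lipschitz    *)
(* bound of a lower order d^B f0 in every direction is read off iterated      *)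
(* finite differences, which commute, so that only the derivatives in the     *)
(* order prescribed by the multi-indices are used.                            *)

Set Implicit Arguments.
Unset Strict Implicit.
Unset Printing Implicit Defensive.

Import Order.TTheory GRing.Theory Num.Theory.

Local Open Scope classical_set_scope.
Local Open Scope ring_scope.

(** * Sorted words, directional derivatives, finite differences *)

(** The comparison is made for each cdf estimator [Fh] separately. It yields the regression
    estimator [mean_estimator Fh], whose risk at a Hölder function [f] is at most the risk of [Fh]
    at the location kernel of [f] ([reg_risk_mean_estimator_le]). This rests on the change of
    variables [integral_iid_location] between the two samples and on the pointwise inequality
    [Rintegral_normal_cdf_sub_dist]. Since all these kernels lie in the smoothness class once [L] is
    small ([location_kernel_cdf_class]), the supremum over cdfs dominates the supremum over the
    Hölder ball. That membership is the analytic core: [partial_word_location] expands the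
    derivatives, [partial_word_cube_hoelder] controls the derivatives of [f], and
    [normal_cdf_derive_envelopes] controls those of the normal cdf. *)

Section words.
Context {d : nat}.
Implicit Types (w v : seq 'I_d) (a : {ffun 'I_d -> nat}).

Definition le_ord : rel 'I_d := fun i j => (i <= j)%N.

Lemma le_ord_trans : transitive le_ord.
Proof. by move=> j i k; exact: leq_trans. Qed.

Lemma le_ord_total : total le_ord.
Proof. by move=> i j; exact: leq_total. Qed.

Lemma mi_word_sorted a : sorted le_ord (mi_word a).
Proof.
rewrite sorted_pairwise; last exact: le_ord_trans.
rewrite /mi_word; have : pairwise (fun i j : 'I_d => i < j)%N (enum 'I_d).
  have := iota_ltn_sorted 0 d; rewrite -val_enum_ord sorted_map.
  by rewrite sorted_pairwise //= => j i k; exact: ltn_trans.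
elim: (enum 'I_d) => //= i s IH /andP[/allP is_ ps].
rewrite pairwise_cat IH // andbT; apply/andP; split.
  apply/allrelP => x y; rewrite mem_nseq => /andP[_ /eqP ->].
  case/flattenP => r /mapP[k ks ->]; rewrite mem_nseq => /andP[_ /eqP ->].
  exact/ltnW/is_.
elim: (a i) => //= n ->; rewrite andbT; apply/allP => x.
by rewrite mem_nseq => /andP[_ /eqP ->]; rewrite /le_ord.
Qed.

Lemma count_mi_word a (i : 'I_d) : count_mem i (mi_word a) = a i.
Proof.
rewrite /mi_word count_flatten -map_comp sumnE big_map big_enum /=.
rewrite (bigD1 i) //= big1 ?addn0 => [|j ji]; last first.
  by rewrite count_nseq /= (negbTE ji) mul0n.
by rewrite count_nseq /= eqxx mul1n.
Qed.

Lemma size_mi_word a : size (mi_word a) = mi_deg a.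
Proof.
rewrite /mi_word size_flatten /shape -map_comp sumnE big_map big_enum /=.
by apply: eq_bigr => j _; rewrite /= size_nseq.
Qed.

(** The words of multi-indices are exactly the sorted words. Bounds indexed by multi-indices thus
    become bounds on sorted words, which allow induction on letters and passage to subwords. *)
Lemma mi_word_count w : sorted le_ord w ->
  mi_word [ffun j => count_mem j w] = w.
Proof.
move=> sw; apply: (sorted_eq (leT := le_ord)) => //.
- exact: le_ord_trans.
- by move=> i j ij; apply/val_inj/anti_leq.
- exact: mi_word_sorted.
- by apply/allP => i _ /=; rewrite count_mi_word ffunE.
Qed.

End words.

(** * Directional derivatives as derivatives along a line *)

Section directional.
Context {R : realType} {V : normedModType R}.
Implicit Types (f : V -> R) (x v : V).

Lemma is_derive_line f x v (s df : R) : is_derive (s *: v + x) v f df ->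
  is_derive s (1 : R) (fun s => f (s *: v + x)) df.
Proof.
case=> dfx <-.
have E : (fun h : R =>
           h^-1 *: (((fun s => f (s *: v + x)) \o shift s) (h *: (1 : R)) -
           f (s *: v + x))) =
         (fun h : R => h^-1 *: ((f \o shift (s *: v + x)) (h *: v) - f (s *: v + x))).
  apply/funext => h /=; rewrite (_ : h *: (1 : R) = h) ?scalerDl ?addrA //.
  exact: mulr1.
by split; rewrite /derivable /derive ?E.
Qed.

Lemma is_derive_from_line f x v (df : R) :
  is_derive (0 : R) (1 : R) (fun s => f (s *: v + x)) df -> is_derive x v f df.
Proof.
case=> dfx <-.
have E : (fun h : R =>
           h^-1 *: (((fun s => f (s *: v + x)) \o shift 0) (h *: (1 : R)) -
           f (0 *: v + x))) =
         (fun h : R => h^-1 *: ((f \o shift x) (h *: v) - f x)).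
  apply/funext => h /=; rewrite scale0r add0r addr0 (_ : h *: (1 : R) = h) //.
  exact: mulr1.
by split; [move: dfx|]; rewrite /derivable /derive ?E.
Qed.

Lemma MVT_line f x v (h : R) : (forall y, derivable f y v) ->
  exists2 s : R, `|s| <= `|h| & f (h *: v + x) - f x = h * 'D_v f (s *: v + x).
Proof.
move=> df; pose g s := f (s *: v + x).
have dg (s : R) : is_derive s (1 : R) g ('D_v f (s *: v + x)).
  exact/is_derive_line/derivableP.
have cg : continuous g.
  by move=> s; apply/differentiable_continuous/derivable1_diffP; case: (dg s).
have g0 : g 0 = f x by rewrite /g scale0r add0r.
have [h0|h0] := leP 0 h.
  have [c] := @MVT_segment R g _ 0 h h0 (fun s _ => dg s)
    (continuous_subspaceT cg).
  rewrite in_itv /= g0 subr0 => /andP[c0 ch] E; exists c; last by rewrite E mulrC.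
  by rewrite !ger0_norm.
have [c] := @MVT_segment R g _ h 0 (ltW h0) (fun s _ => dg s)
  (continuous_subspaceT cg).
rewrite in_itv /= g0 sub0r => /andP[c0 ch] E; exists c.
  by rewrite !ler0_norm ?lerN2 // ltW.
by rewrite -opprB E mulrN opprK mulrC.
Qed.

Lemma norm_derive_le f x v (M : R) : derivable f x v ->
  (forall h, `|f (h *: v + x) - f x| <= M * `|h|) -> `|'D_v f x| <= M.
Proof.
move=> dfx H.
have : (fun h : R => `|h^-1 *: ((f \o shift x) (h *: v) - f x)|) @ 0^' --> `|'D_v f x|.
  by apply: cvg_norm; exact: dfx.
move=> C; rewrite -(cvg_lim (@Rhausdorff R) C); apply: limr_le; first exact: cvgP C.
near=> h; have h0 : h != 0 by near: h; exact: nbhs_dnbhs_neq.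
by rewrite normrZ normfV ler_pdivrMl ?normr_gt0 // mulrC; exact: H.
Unshelve. all: by end_near. Qed.

End directional.

(** * Commuting finite differences and derivatives along words *)

Section finite_differences.
Context {R : realType} {d : nat}.
Implicit Types (f g : 'rV[R]_d -> R) (x y : 'rV[R]_d) (w : seq ('I_d * R)).

(** Each letter carries its own step, so that the steps of an iterated difference can tend to 0 one
    at a time. *)
Definition delta (p : 'I_d * R) f : 'rV[R]_d -> R :=
  fun x => f (p.2 *: delta_mx ord0 p.1 + x) - f x.

Definition delta_word w f : 'rV[R]_d -> R := foldr delta f w.

Lemma deltaC p q f : delta p (delta q f) = delta q (delta p f).
Proof.
by apply/funext => x; rewrite /delta (addrCA (p.2 *: _)); ring.
Qed.

Lemma delta_wordC p w f : delta_word w (delta p f) = delta p (delta_word w f).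
Proof. by elim: w => //= q w ->; rewrite deltaC. Qed.

Lemma delta_word_perm w w' f : perm_eq w w' -> delta_word w f = delta_word w' f.
Proof.
move=> ww'; pose P s := delta_word w f = delta_word s f.
apply: (@catCA_perm_ind _ P) ww' erefl => s1 s2 s3; rewrite /P => ->.
rewrite /delta_word !foldr_cat -!/(delta_word _ _).
elim: s1 => //= p s1 ->; exact/esym/delta_wordC.
Qed.

Lemma is_derive_delta (v : 'rV[R]_d) p f : (forall x, derivable f x v) ->
  forall x, is_derive x v (delta p f) (delta p (fun x => 'D_v f x) x).
Proof.
move=> df x; apply: is_deriveB; last exact/derivableP.
apply: is_derive_from_line; set c := _ *: _.
rewrite [X in is_derive _ _ X _](_ : _ = fun s => f (s *: v + (c + x))).
  by apply: is_derive_line; rewrite scale0r add0r; exact/derivableP.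
by apply/funext => s; rewrite addrCA.
Qed.

Lemma derivable_delta_word (v : 'rV[R]_d) w f : (forall x, derivable f x v) ->
  (forall x, derivable (delta_word w f) x v) /\
  (fun x => 'D_v (delta_word w f) x) = delta_word w (fun x => 'D_v f x).
Proof.
move=> df; elim: w => //= p w [IHd IHe]; split => [x|].
  by case: (is_derive_delta p IHd x).
apply/funext => x; case: (is_derive_delta p IHd x) => _ ->.
by rewrite IHe.
Qed.

Lemma partial_word_rcons (s : seq 'I_d) j f :
  partial_word (rcons s j) f = partial_word s (partial j f).
Proof. by rewrite /partial_word foldr_rcons. Qed.

Lemma has_partial_word_rcons (s : seq 'I_d) j f :
  has_partial_word (rcons s j) f <->
  (forall x, derivable f x (delta_mx ord0 j)) /\ has_partial_word s (partial j f).
Proof.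
elim: s => [|i s [IH1 IH2]] /=; first by split => [[]|[]].
split => [[/IH1[? ?] ?]|[? [? ?]]]; first by rewrite -partial_word_rcons.
by rewrite partial_word_rcons; split => //; exact: IH2.
Qed.

Lemma has_partial_word_delta (s : seq 'I_d) p f : has_partial_word s f ->
  has_partial_word s (delta p f) /\
  partial_word s (delta p f) = delta p (partial_word s f).
Proof.
elim: s => //= j s IH [/IH[hs es] dj].
split; first by split=> // x; rewrite es; case: (is_derive_delta p dj x).
by apply/funext => x; rewrite /partial es; case: (is_derive_delta p dj x).
Qed.

(* Iterated mean value theorem: only the derivatives taken in the order of    *)
(* the word are used, so that no symmetry of mixed derivatives is needed.     *)
Lemma MVT_word w f x : has_partial_word (map fst w) f ->
  exists y, delta_word w f x =
    (\prod_(p <- w) p.2) * partial_word (map fst w) f y.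
Proof.
elim/last_ind: w f x => [|w [j h] IH] f x.
  by move=> _; exists x; rewrite big_nil mul1r.
rewrite map_rcons => /has_partial_word_rcons[/= dj hw].
have [dw ew] := derivable_delta_word w dj.
have [s _ E] := MVT_line x h dw.
have [y Ey] := IH _ (s *: delta_mx ord0 j + x) hw; exists y.
have -> : delta_word (rcons w (j, h)) f x =
    h * delta_word w (partial j f) (s *: delta_mx ord0 j + x).
  rewrite /delta_word foldr_rcons -/(delta_word _ _) delta_wordC.
  rewrite /delta /= E; congr (_ * _); exact: (congr1 (@^~ _) ew).
by rewrite Ey big_rcons partial_word_rcons /=; ring.
Qed.

(** A converse to [MVT_word]: differences are divided by their steps, which are sent to 0 one after
    the other. The last letter of a word is the innermost derivative, hence the induction from the
    right. *)
Lemma norm_partial_word_le (s : seq 'I_d) g (M : R) : has_partial_word s g ->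
  (forall w x, map fst w = s ->
     `|delta_word w g x| <= M * \prod_(p <- w) `|p.2|) ->
  forall x, `|partial_word s g x| <= M.
Proof.
elim/last_ind: s g => [|s j IH] g.
  by move=> _ /(_ [::]) H x; have := H x erefl; rewrite big_nil mulr1.
move=> /has_partial_word_rcons[dj hs] H x; rewrite partial_word_rcons.
apply: IH => // w {}x ws; have [dw ew] := derivable_delta_word w dj.
have <- : 'D_(delta_mx ord0 j) (delta_word w g) x = delta_word w (partial j g) x.
  exact: (congr1 (@^~ x) ew).
apply: norm_derive_le => // h.
have := H (rcons w (j, h)) x; rewrite map_rcons ws => /(_ erefl).
rewrite big_rcons /= /delta_word foldr_rcons -/(delta_word _ _) delta_wordC.
by rewrite /delta /= mulrA mulrAC.
Qed.

(** The derivative along [s] is replaced by differences along [s]. Together with the difference [p]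
    they can be put in sorted order, where [MVT_word] and the bound [M] apply; letting the steps of
    [s] tend to 0 gives back the derivative. *)
Lemma delta_partial_word_le (s : seq 'I_d) p f (M : R) : 
  has_partial_word s f ->
  (forall C, sorted le_ord C -> perm_eq C (p.1 :: s) ->
    has_partial_word C f /\ forall x, `|partial_word C f x| <= M) ->
  forall x, `|delta p (partial_word s f) x| <= M * `|p.2|.
Proof.
move=> hs HC x; have [hd <-] := has_partial_word_delta p hs.
apply: norm_partial_word_le x => // w x ws.
pose w' := sort (relpre fst le_ord) (p :: w).
have pw : perm_eq w' (p :: w) by rewrite perm_sort.
rewrite delta_wordC -[delta p _]/(delta_word (p :: w) f) -(delta_word_perm _ pw).
have [||hC bC] := HC (map fst w').
- by rewrite sorted_map; apply: sort_sorted => i j; exact: le_ord_total.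
- by rewrite -ws -[_ :: map _ _]/(map fst (p :: w)); exact: perm_map.
have [y ->] := MVT_word x hC.
rewrite normrM -mulrA mulrC ler_pM // normr_prod.
by rewrite (perm_big _ pw) big_cons.
Qed.

(** The point [x] is reached from [y] by moving one coordinate at a time; in the sup-norm each move
    has length at most [|x - y|], whence the factor [d]. *)
Lemma lipschitz_of_coordinates f (M : R) : 0 <= M ->
  (forall p x, `|delta p f x| <= M * `|p.2|) ->
  forall x y, `|f x - f y| <= d%:R * M * `|x - y|.
Proof.
move=> M0 H x y.
have key (s : seq 'I_d) :
  `|f (\sum_(j <- s) (x - y) ord0 j *: delta_mx ord0 j + y) - f y| <=
     (size s)%:R * M * `|x - y|.
  elim: s => [|j s IH]; first by rewrite big_nil add0r subrr normr0 !mul0r.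
  rewrite big_cons -addrA; set z := _ + y in IH *.
  have -> : f ((x - y) ord0 j *: delta_mx ord0 j + z) - f y =
      delta (j, (x - y) ord0 j) f z + (f z - f y) by rewrite /delta /=; ring.
  rewrite (le_trans (ler_normD _ _)) // -[(size (_ :: _))%:R]natr1 !mulrDl mul1r.
  rewrite addrC lerD // (le_trans (H _ _)) //= ler_wpM2l //.
  rewrite [leRHS]/Num.Def.normr /= mx_normrE.
  by apply/bigmax_geP; right => /=; exists (ord0, j).
have := key (enum 'I_d); rewrite size_enum_ord big_enum /= -row_sum_delta.
by rewrite subrK.
Qed.

End finite_differences.

(** * Derivatives of functions of the Hoelder class *)

Section hoelder_bounds.
Context {R : realType} {d : nat}.
Variables (L beta : R) (f : 'rV[R]_d -> R).
Hypotheses (hd : (0 < d)%N) (hbeta : 0 < beta) (Hf : hoelder_class L beta f).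

Local Notation l := (smooth_int beta).
Local Notation g := (smooth_frac beta).

Lemma smooth_frac_gt0 : 0 < g.
Proof. by have [_ /andP[]] := smooth_decomp hbeta. Qed.

Lemma smooth_frac_le1 : g <= 1.
Proof. by have [_ /andP[]] := smooth_decomp hbeta. Qed.

Lemma size_sorted_count (w : seq 'I_d) : sorted le_ord w ->
  mi_deg [ffun j => count_mem j w] = size w.
Proof. by move=> sw; rewrite -size_mi_word mi_word_count. Qed.

Lemma has_sorted_partial (w : seq 'I_d) : sorted le_ord w -> (size w <= l)%N ->
  has_partial_word w f.
Proof.
move=> sw wl; case: Hf => /(_ [ffun j => count_mem j w]) + _.
by rewrite size_sorted_count // /has_mi_partial mi_word_count //; exact.
Qed.

Lemma sup_norm_ge0 (h : 'rV[R]_d -> R) : (0 <= sup_norm h)%E.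
Proof. by apply: le_trans (ereal_sup_ubound _); last by exists 0; rewrite ?lee_fin. Qed.

(** An empty supremum would be [-oo]; [0 < d] provides a multi-index of degree [l] and two distinct
    points. *)
Lemma seminorm_ge0 : (0 <= hoelder_seminorm l g f)%E.
Proof.
apply: le_trans (ereal_sup_ubound _); last first.
  exists [ffun j => if j == Ordinal hd then l else 0%N], (const_mx 1), 0; split.
  - rewrite /mi_deg (bigD1 (Ordinal hd)) //= big1 ?addn0 ?ffunE ?eqxx // => j.
    by rewrite ffunE => /negbTE ->.
  - move=> /matrixP /(_ ord0 (Ordinal hd)); rewrite !mxE => /eqP.
    by rewrite oner_eq0.
  - reflexivity.
by rewrite lee_fin divr_ge0 ?powR_ge0.
Qed.

Lemma esum_sup_norm_ge0 : (0 <= \esum_(a in [set a | (mi_deg a < l)%N])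
  sup_norm (mi_partial a f))%E.
Proof. by apply: esum_ge0 => a _; exact: sup_norm_ge0. Qed.

Lemma partial_word_bound (w : seq 'I_d) x : sorted le_ord w -> (size w < l)%N ->
  `|partial_word w f x| <= L.
Proof.
move=> sw wl; pose a := [ffun j => count_mem j w].
have -> : partial_word w f = mi_partial a f by rewrite /mi_partial mi_word_count.
rewrite -lee_fin; case: Hf => _; apply: le_trans.
rewrite -[leLHS]adde0; apply: leeD seminorm_ge0.
apply: esum_ge; exists [set a]; last first.
  by rewrite fsbig_set1; apply: ereal_sup_ubound; exists x.
split; first exact: finite_set1.
by move=> _ -> /=; rewrite size_sorted_count.
Qed.

Lemma partial_word_hoelder (w : seq 'I_d) x y : sorted le_ord w -> size w = l ->
  `|partial_word w f x - partial_word w f y| <= L * `|x - y| `^ g.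
Proof.
move=> sw wl; pose a := [ffun j => count_mem j w].
have -> : partial_word w f = mi_partial a f by rewrite /mi_partial mi_word_count.
have [->|/eqP xy] := eqVneq x y.
  by rewrite !subrr !normr0 powR0 ?mulr0 // gt_eqF // smooth_frac_gt0.
rewrite -ler_pdivrMr; last by rewrite powR_gt0 // normr_gt0 subr_eq0; exact/eqP.
rewrite -lee_fin; case: Hf => _; apply: le_trans.
rewrite -[leLHS]add0e; apply: leeD esum_sup_norm_ge0 _.
apply: ereal_sup_ubound; exists a, x, y; split => //.
by rewrite size_sorted_count.
Qed.

Lemma hoelder_const_ge0 : 0 <= L.
Proof.
rewrite -lee_fin; case: Hf => _; apply: le_trans.
by rewrite adde_ge0 ?seminorm_ge0 ?esum_sup_norm_ge0.
Qed.

Lemma norm_delta_mx_le1 (j : 'I_d) : `|delta_mx ord0 j : 'rV[R]_d| <= 1.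
Proof.
rewrite [leLHS]/Num.Def.normr /= mx_normrE; apply/bigmax_leP; split => // i _.
by rewrite mxE; case: (_ && _); rewrite ?normr1 ?normr0.
Qed.

(* The norm of [hoelder_class] does not contain the sup norms of the          *)
(* derivatives of top order; they are controlled by the mean value theorem.   *)
Lemma partial_word_top_bound (w : seq 'I_d) x : sorted le_ord w -> size w = l ->
  (0 < l)%N -> `|partial_word w f x| <= 3 * L.
Proof.
move=> sw wl l0; case: w sw wl => [|j v] sw wl; first by rewrite -wl in l0.
have sv : sorted le_ord v by exact: path_sorted sw.
have vl : (size v < l)%N by rewrite -wl.
have [_ dv] : has_partial_word (j :: v) f by apply: has_sorted_partial; rewrite ?wl.
have [s + E] := MVT_line x 1 dv; rewrite normr1 mul1r -/(partial j _) in E * => s1.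
have -> : partial_word (j :: v) f x = (partial_word (j :: v) f x -
   partial_word (j :: v) f (s *: delta_mx ord0 j + x)) +
   (partial_word v f (1 *: delta_mx ord0 j + x) - partial_word v f x).
  by rewrite E /= /partial; ring.
rewrite (le_trans (ler_normD _ _)) // (_ : 3 * L = L + (L + L)); last by ring.
rewrite lerD //; last first.
  by rewrite (le_trans (ler_normB _ _)) // lerD // partial_word_bound.
rewrite (le_trans (partial_word_hoelder _ _ sw wl)) //.
rewrite -[leRHS]mulr1 ler_wpM2l ?hoelder_const_ge0 //.
have n1 : `|x - (s *: delta_mx ord0 j + x)| <= 1.
  rewrite opprD addrCA subrr addr0 normrN normrZ mulr_ile1 //.
  exact: norm_delta_mx_le1.
have := @ge0_ler_powR _ g (ltW smooth_frac_gt0) `|x - (s *: delta_mx ord0 j + x)| 1.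
by rewrite !nnegrE normr_ge0 ler01 powR1; exact.
Qed.

Lemma partial_word_le3 (w : seq 'I_d) x : sorted le_ord w -> (size w <= l)%N ->
  (0 < l)%N -> `|partial_word w f x| <= 3 * L.
Proof.
move=> sw; rewrite leq_eqVlt => /orP[/eqP|] wl l0.
  exact: partial_word_top_bound.
rewrite (le_trans (partial_word_bound _ _ _)) // -[leLHS]mul1r.
by rewrite ler_wpM2r ?hoelder_const_ge0 // ler1n.
Qed.

Lemma partial_word_lipschitz (w : seq 'I_d) x y : sorted le_ord w ->
  (size w < l)%N ->
  `|partial_word w f x - partial_word w f y| <= d%:R * (3 * L) * `|x - y|.
Proof.
move=> sw wl; apply: lipschitz_of_coordinates => [|p {}x].
  by rewrite mulr_ge0 ?hoelder_const_ge0.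
apply: delta_partial_word_le => [|C sC /perm_size /= CE].
  by apply: has_sorted_partial => //; exact: ltnW.
have Cl : (size C <= l)%N by rewrite CE.
split=> [|{}x]; first exact: has_sorted_partial.
by apply: partial_word_le3 => //; exact: leq_ltn_trans wl.
Qed.

Lemma unit_cube_dist (x y : 'rV[R]_d) : unit_cube x -> unit_cube y ->
  `|x - y| <= 1.
Proof.
move=> cx cy; rewrite [leLHS]/Num.Def.normr /= mx_normrE.
apply/bigmax_leP; split => // -[i j] _ /=; rewrite !mxE (ord1 i).
have /andP[x0 x1] := cx j; have /andP[y0 y1] := cy j.
by rewrite ler_norml; apply/andP; split; lra.
Qed.

(** Distances in the cube are at most 1 and [g <= 1], so there a Lipschitz bound implies a Hölder
    bound. This gives all orders up to [l] the same modulus. *)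
Lemma partial_word_cube_hoelder (w : seq 'I_d) x y : sorted le_ord w ->
  (size w <= l)%N -> unit_cube x -> unit_cube y ->
  `|partial_word w f x - partial_word w f y| <= d%:R * (3 * L) * `|x - y| `^ g.
Proof.
move=> sw wl cx cy; have L0 := hoelder_const_ge0.
move: wl; rewrite leq_eqVlt => /orP[/eqP wl|wl].
  rewrite (le_trans (partial_word_hoelder _ _ sw wl)) // ler_wpM2r ?powR_ge0 //.
  rewrite mulrA -[leLHS]mul1r ler_wpM2r // -natrM ler1n muln_gt0.
  by rewrite hd.
rewrite (le_trans (partial_word_lipschitz _ _ sw wl)) // ler_wpM2l //.
  by rewrite !mulr_ge0.
have [->|/eqP xy] := eqVneq x y; first by rewrite subrr normr0 powR_ge0.
rewrite -[leLHS]powRr1 // ger_powR ?smooth_frac_le1 //.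
by rewrite normr_gt0 subr_eq0 unit_cube_dist // andbT; exact/eqP.
Qed.

Lemma hoelder_continuous : continuous f.
Proof.
have L0 := hoelder_const_ge0; have g0 := smooth_frac_gt0.
pose C := d%:R * (3 * L) + L.
have C0 : 0 <= C by rewrite addr_ge0 // !mulr_ge0.
have key x y : `|f x - f y| <= C * `|x - y| \/ `|f x - f y| <= C * `|x - y| `^ g.
  have [l0|l0] := posnP l; [right|left].
    apply: le_trans (@partial_word_hoelder [::] x y _ _) _ => //.
    by rewrite ler_wpM2r ?powR_ge0 // lerDr !mulr_ge0.
  apply: le_trans (@partial_word_lipschitz [::] x y _ _) _ => //.
  by rewrite ler_wpM2r // lerDl.
have C1 : 0 < C + 1 by rewrite ltr_wpDl.
move=> x; apply/(@cvgrPdist_lt _ _ _ (nbhs x) (nbhs_filter x)) => e e0.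
(* This radius makes both [|x - y|] and its power [g] at most [e / (C + 1)], so it serves both cases
   of [key]; [C + 1] is used because [C] may vanish. *)
pose r := Num.min (e / (C + 1)) ((e / (C + 1)) `^ g^-1).
have r0 : 0 < r by rewrite lt_min divr_gt0 // powR_gt0 // divr_gt0.
have near_x : nbhs x [set y : 'rV[R]_d | `|x - y| < r].
  by have := nbhsx_ballx x r r0; rewrite -ball_normE.
apply: filterS near_x => y /= xy.
have [xy1 xy2] : `|x - y| <= e / (C + 1) /\ `|x - y| `^ g <= e / (C + 1).
  move: xy; rewrite lt_min => /andP[/ltW ? /ltW xy2]; split => //.
  have : `|x - y| `^ g <= ((e / (C + 1)) `^ g^-1) `^ g.
    by apply: ge0_ler_powR => //; rewrite ?nnegrE ?powR_ge0 // ltW.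
  by rewrite -powRrM mulVf ?gt_eqF // powRr1 // divr_ge0 // ltW.
have Ce z : z <= e / (C + 1) -> C * z < e.
  move=> ze; apply: le_lt_trans (ler_wpM2l C0 ze) _.
  by rewrite mulrA ltr_pdivrMr // mulrC ltr_pM2l // ltrDl.
by case: (key x y) => /le_lt_trans; apply; exact: Ce.
Qed.

End hoelder_bounds.

(** * The Faa di Bruno formula *)

Section partition_sums.
Context {d : nat}.
Implicit Types (l m : seq (seq 'I_d)) (w : seq 'I_d).

(* A partition of the set of positions of a word is recorded as the list of   *)
(* the subwords read along its blocks; all of them are sorted if the word is. *)
Fixpoint enlarge_block (j : 'I_d) l : seq (seq (seq 'I_d)) :=
  if l is B :: l' then ((j :: B) :: l') :: [seq B :: m | m <- enlarge_block j l']
  else [::].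

(** Differentiating a term in direction [j] hits either the outer function, which opens the block
    [[:: j]], or one of the factors, whose block receives [j]. *)
Definition add_letter j l := ([:: j] :: l) :: enlarge_block j l.

Definition word_partitions w : seq (seq (seq 'I_d)) :=
  foldr (fun j E => flatten [seq add_letter j l | l <- E]) [:: [::]] w.

Lemma size_enlarge_block j l m : m \in enlarge_block j l -> size m = size l.
Proof.
elim: l m => //= B l IH m; rewrite inE => /orP[/eqP -> //|/mapP[m' m'l ->]].
by rewrite /= (IH m').
Qed.

Lemma mem_enlarge_block j l m B : m \in enlarge_block j l -> B \in m ->
  B \in l \/ exists2 B', B' \in l & B = j :: B'.
Proof.
elim: l m => //= C l IH m; rewrite inE => /orP[/eqP ->|/mapP[m' m'l ->]].
  rewrite inE => /orP[/eqP ->|Bl]; last by left; rewrite inE Bl orbT.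
  by right; exists C; rewrite ?inE ?eqxx.
rewrite !inE => /orP[->|/(IH _ m'l)[->|[B' B'l ->]]]; [by left|by left; rewrite orbT|].
by right; exists B'; rewrite ?inE ?B'l ?orbT.
Qed.

(** Blocks are subwords, so they inherit sortedness; the bound on their number limits the order of
    the derivatives of the outer function. *)
Lemma word_partitions_blocks w l : l \in word_partitions w ->
  (size l <= size w)%N /\ (forall B, B \in l -> subseq B w /\ (0 < size B)%N).
Proof.
elim: w l => [|j w IH] l /=; first by rewrite inE => /eqP ->.
case/flattenP => E /mapP[m /IH[ms mB] ->]; rewrite /add_letter inE.
have mono B : B \in m -> subseq B (j :: w) /\ (0 < size B)%N.
  move=> /mB[Bw B0]; split => //.
  by apply: subseq_trans Bw _; exact: (suffix_subseq [:: j] w).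
case/orP => [/eqP ->|lm]; split => //.
- move=> B; rewrite inE => /orP[/eqP -> |]; last exact: mono.
  by rewrite /= eqxx sub0seq.
- by rewrite (size_enlarge_block lm) ltnW.
- move=> B /(mem_enlarge_block lm)[/mono //|[B' /mB[B'w B'0] ->]].
  by rewrite /= eqxx.
Qed.

End partition_sums.

Section faa_di_bruno.
Context {R : realType} {d : nat}.
Variables (f : 'rV[R]_d -> R) (N : nat) (phi : nat -> R -> R).
Hypothesis hf : forall w, sorted le_ord w -> (size w <= N)%N -> has_partial_word w f.
Hypothesis hphi : forall k (u : R), is_derive u (1 : R) (phi k) (phi k.+1 u).
Implicit Types (l m : seq (seq 'I_d)) (w : seq 'I_d) (x : 'rV[R]_d).

Definition block_product l x : R := \prod_(B <- l) partial_word B f x.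

(** A term of the Faa di Bruno formula for [phi 0 (t - f x)]; the sign comes from the minus in front
    of [f], once per block. *)
Definition partition_term l (t : R) x : R :=
  (-1) ^+ size l * phi (size l) (t - f x) * block_product l x.

Lemma is_derive_block_product j l x :
  (forall B, B \in l -> derivable (partial_word B f) x (delta_mx ord0 j)) ->
  is_derive x (delta_mx ord0 j) (block_product l)
    (\sum_(m <- enlarge_block j l) block_product m x).
Proof.
elim: l => [|B l IH] dl.
  rewrite big_nil [block_product _](_ : _ = cst 1) ?funeqE => [|y].
    exact: is_derive_cst.
  by rewrite /block_product big_nil.
have dB : is_derive x (delta_mx ord0 j) (partial_word B f) (partial_word (j :: B) f x).
  by apply/derivableP/dl; rewrite inE eqxx.
have dP := IH (fun C Cl => dl C (mem_behead (s := B :: l) Cl)).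
have E m : block_product (B :: m) = partial_word B f * block_product m.
  by apply/funext => y; rewrite /block_product big_cons.
rewrite E; apply: is_derive_eq (is_deriveM dB dP) _.
rewrite /= big_cons big_map addrC /block_product big_cons; congr (_ + _).
  by rewrite [RHS]mulrC.
rewrite /GRing.scale /= mulr_sumr.
by apply: eq_bigr => m _; rewrite big_cons.
Qed.

Lemma is_derive_partition_term j l t x :
  derivable f x (delta_mx ord0 j) ->
  (forall B, B \in l -> derivable (partial_word B f) x (delta_mx ord0 j)) ->
  is_derive x (delta_mx ord0 j) (partition_term l t)
    (\sum_(m <- add_letter j l) partition_term m t x).
Proof.
move=> df dl; have dP := is_derive_block_product dl.
pose v : 'rV[R]_d := delta_mx ord0 j.
have dphi : is_derive x v (fun x => phi (size l) (t - f x))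
    (- (phi (size l).+1 (t - f x) * partial j f x)).
  apply: is_derive_from_line.
  have d1 : is_derive (0 : R) (1 : R) (fun s => t - f (s *: v + x)) (- partial j f x).
    rewrite -[- partial j f x]sub0r; apply: is_deriveB.
    by apply: is_derive_line; rewrite scale0r add0r; exact/derivableP.
  have d2 := hphi (size l) (t - f (0 *: v + x)).
  apply: is_derive_eq (is_derive1_comp (f := phi (size l))
    (g := fun s => t - f (s *: v + x)) d2 d1) _.
  by rewrite scale0r add0r -mulrN /GRing.scale /= mulrC.
have dc := is_deriveM (is_deriveM (is_derive_cst ((-1) ^+ size l : R) x v) dphi) dP.
apply: (is_derive_eq dc).
rewrite /add_letter big_cons /GRing.scale /= mulr0 addr0 addrC /partition_term.
rewrite [block_product (_ :: _) x]big_cons -/(block_product l x) /= exprS.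
congr (_ + _); first by rewrite /partial; ring.
rewrite mulr_sumr; apply: eq_big_seq => m ml.
by rewrite (size_enlarge_block ml).
Qed.

Lemma is_derive_big_seq (I : eqType) (s : seq I) (F : I -> 'rV[R]_d -> R)
    (dF : I -> R) x v :
  (forall i, i \in s -> is_derive x v (F i) (dF i)) ->
  is_derive x v (fun y => \sum_(i <- s) F i y) (\sum_(i <- s) dF i).
Proof.
elim: s => [|i s IH] H.
  rewrite big_nil [X in is_derive _ _ X _](_ : _ = cst 0) ?funeqE => [|y].
    exact: is_derive_cst.
  by rewrite big_nil.
rewrite big_cons [X in is_derive _ _ X _](_ : _ = F i + fun y => \sum_(i <- s) F i y).
  apply: is_deriveD; first by apply: H; rewrite inE eqxx.
  by apply: IH => k ks; apply: H; rewrite inE ks orbT.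
by apply/funext => y; rewrite big_cons.
Qed.

Lemma partial_word_location w t : sorted le_ord w -> (size w <= N)%N ->
  has_partial_word w (fun x => phi 0 (t - f x)) /\
  partial_word w (fun x => phi 0 (t - f x)) =
    fun x => \sum_(l <- word_partitions w) partition_term l t x.
Proof.
elim: w => [|j w IH] sw wN.
  split=> //=; apply/funext => x; rewrite big_seq1 /partition_term /block_product.
  by rewrite big_nil expr0 mul1r mulr1.
have [hw ew] := IH (path_sorted sw) (ltnW wN).
(* As a subword of [j :: w], the word [j :: B] is sorted and short enough, so [hf] covers the
   derivative of each factor in direction [j]. *)
have dsub B x : subseq B w -> derivable (partial_word B f) x (delta_mx ord0 j).
  move=> Bw; have jBw : subseq (j :: B) (j :: w) by rewrite /= eqxx.
  have [||//] := @hf (j :: B).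
  - by apply: subseq_sorted jBw sw; exact: le_ord_trans.
  - exact: leq_trans (size_subseq jBw) wN.
have key x : is_derive x (delta_mx ord0 j)
    (partial_word w (fun x => phi 0 (t - f x)))
    (\sum_(l <- word_partitions (j :: w)) partition_term l t x).
  rewrite ew /= big_flatten big_map; apply: is_derive_big_seq => l lw.
  have [_ lB] := word_partitions_blocks lw.
  apply: is_derive_partition_term; first exact: (dsub [::] x (sub0seq w)).
  by move=> B /lB[Bw _]; exact: dsub.
split; first by split => // x; case: (key x).
by apply/funext => x; case: (key x).
Qed.

End faa_di_bruno.

(** Telescoping: factors are exchanged one at a time, each exchange costing at most [e] because all
    other factors are bounded by 1. *)
Lemma prod_seq_dist {R : realDomainType} (I : eqType) (s : seq I)
    (a b : I -> R) (e : R) :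
  (forall i, i \in s -> [/\ `|a i| <= 1, `|b i| <= 1 & `|a i - b i| <= e]) ->
  `|\prod_(i <- s) b i| <= 1 /\
  `|\prod_(i <- s) a i - \prod_(i <- s) b i| <= (size s)%:R * e.
Proof.
elim: s => [|i s IH] H; first by rewrite !big_nil subrr normr0 normr1 mul0r.
have [p1 pd] := IH (fun k ks => H k (mem_behead (s := i :: s) ks)).
have [a1 b1 ab] := H i (mem_head _ _); rewrite !big_cons; split.
  by rewrite normrM mulr_ile1.
set A := \prod_(_ <- _) a _ in pd *; set B := \prod_(_ <- _) b _ in p1 pd *.
have -> : a i * A - b i * B = a i * (A - B) + (a i - b i) * B by ring.
rewrite (le_trans (ler_normD _ _)) // !normrM -[(size (_ :: _))%:R]natr1 mulrDl mul1r.
apply: lerD; first by rewrite -[leRHS]mul1r ler_pM.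
by rewrite -[leRHS]mulr1 ler_pM.
Qed.

(** * The derivatives of the normal cdf *)

Section gaussian_cdf.
Context {R : realType}.
Implicit Types (u v : R) (k n : nat) (p : {poly R}).

Definition normal_cdf u : R := fine (normal_prob 0 1 `]-oo, u]%classic).

(** Up to the sign [(-1) ^+ k], the Hermite polynomials of probability theory: the density times
    [gauss_poly k] is its [k]-th derivative. *)
Fixpoint gauss_poly k : {poly R} :=
  if k is j.+1 then (gauss_poly j)^`() - 'X * gauss_poly j else 1.

Definition normal_cdf_derive k u : R :=
  if k is j.+1 then (gauss_poly j).[u] * normal_pdf 0 1 u else normal_cdf u.

Lemma normal_pdf01E u : normal_pdf 0 1 u = normal_peak 1 * expR (- (u ^+ 2 / 2)).
Proof.
rewrite normal_pdfE ?oner_neq0 //= /normal_fun subr0 expr1n mulNr.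
by congr (_ * expR (- (_ / _))); rewrite -mulr_natl mulr1.
Qed.

Lemma normal_pdf02E u : normal_pdf 0 2 u = normal_peak 2 * expR (- (u ^+ 2 / 8)).
Proof.
rewrite normal_pdfE ?pnatr_eq0 //= /normal_fun subr0 mulNr.
by congr (_ * expR (- (_ / _))); rewrite -mulr_natl; ring.
Qed.

Lemma is_derive_normal_pdf u :
  is_derive u (1 : R) (normal_pdf 0 1) (- u * normal_pdf 0 1 u).
Proof.
have -> : normal_pdf (0 : R) 1 = fun u => normal_peak 1 * expR (- (u ^+ 2 / 2)).
  by apply/funext => v; exact: normal_pdf01E.
have d2 : is_derive u (1 : R) (fun u : R => - (u ^+ 2 / 2)) (- u).
  apply: is_derive_eq.
  by rewrite /GRing.scale /=; field.
have d1 := is_derive1_comp (f := expR) (g := fun u : R => - (u ^+ 2 / 2))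
  (is_derive_expR _) d2.
have d3 := is_deriveZ (normal_peak 1) d1.
by apply: is_derive_eq d3 _; rewrite /GRing.scale /=; ring.
Qed.

Lemma is_derive_normal_cdf u : is_derive u (1 : R) normal_cdf (normal_pdf 0 1 u).
Proof.
have uu : u < u + 1 by rewrite ltrDl.
have int : lebesgue_measure.-integrable [set` Interval -oo%O (BRight (u + 1))]
    (EFin \o normal_pdf (0 : R) 1).
  exact: integrableS (integrable_normal_pdf 0 1).
have [dF eF] := continuous_FTC1 uu int (ltNyr _)
  (@continuous_normal_pdf R 0 1 (oner_neq0 _) u).
by rewrite derive1E in eF; exact: DeriveDef dF eF.
Qed.

Lemma is_derive_normal_cdf_derive k u :
  is_derive u (1 : R) (normal_cdf_derive k) (normal_cdf_derive k.+1 u).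
Proof.
case: k => [|k] /=; first by rewrite hornerC mul1r; exact: is_derive_normal_cdf.
have dp := @is_derive_poly R (gauss_poly k) u.
apply: is_derive_eq (is_deriveM dp (is_derive_normal_pdf u)) _.
by rewrite !hornerE /GRing.scale /=; ring.
Qed.

(** The exponential is the power [n.+1] of [expR (z / n.+1%:R)], which is at least
    [1 + z / n.+1%:R]. The exponent [n.+1] avoids a division by 0 when [n = 0]. *)
Lemma expr_le_expR n u : `|u| ^+ n <= (4 * n.+1%:R) ^+ n.+1 * expR (u ^+ 2 / 4).
Proof.
set z := u ^+ 2 / 4; have z0 : 0 <= z by rewrite divr_ge0 // sqr_ge0.
have n0 : 0 < n.+1%:R :> R by [].
have u1 : `|u| <= 1 + u ^+ 2.
  have := sqr_ge0 (`|u| - 1); rewrite -[u ^+ 2]real_normK ?num_real //.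
  by have := normr_ge0 u; nra.
have -> : expR z = expR (z / n.+1%:R) ^+ n.+1.
  by rewrite -expRM_natl mulrC mulfVK // gt_eqF.
rewrite -exprMn.
have : `|u| ^+ n <= (1 + u ^+ 2) ^+ n.+1.
  apply: le_trans (_ : (1 + u ^+ 2) ^+ n <= _).
    by rewrite lerXn2r ?nnegrE // (le_trans _ u1) //.
  by rewrite ler_weXn2l // lerDl sqr_ge0.
move=> /le_trans; apply.
rewrite lerXn2r ?nnegrE ?addr_ge0 ?sqr_ge0 ?mulr_ge0 ?expR_ge0 //.
apply: le_trans (_ : 4 * n.+1%:R * (1 + z / n.+1%:R) <= _); last first.
  by rewrite ler_wpM2l ?expR_ge1Dx ?mulr_ge0.
rewrite mulrDr mulr1 mulrA [4 * _ * z]mulrAC mulfK ?gt_eqF // /z.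
rewrite mulrCA divff ?pnatr_eq0 // mulr1 lerD2r.
by rewrite -natrM ler1n.
Qed.

Lemma poly_le_expR p :
  exists2 C, 0 <= C & forall u, `|p.[u]| <= C * expR (u ^+ 2 / 4).
Proof.
exists (\sum_(i < size p) `|p`_i| * (4 * i.+1%:R) ^+ i.+1).
  by apply: sumr_ge0 => i _; rewrite mulr_ge0 // exprn_ge0 // mulr_ge0.
move=> u; rewrite horner_coef (le_trans (ler_norm_sum _ _ _)) // mulr_suml.
by apply: ler_sum => i _; rewrite normrM normrX -mulrA ler_wpM2l // expr_le_expR.
Qed.

(** Half of the Gaussian exponent absorbs the polynomial. *)
Lemma normal_cdf_derive_bound k : exists2 C, 0 <= C &
  forall u, `|normal_cdf_derive k.+1 u| <= C * expR (- (u ^+ 2 / 4)).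
Proof.
have [C C0 HC] := poly_le_expR (gauss_poly k).
exists (C * normal_peak 1); first by rewrite mulr_ge0 ?normal_peak_ge0.
move=> u; rewrite /= normrM normal_pdf01E.
rewrite (ger0_norm (mulr_ge0 _ (expR_ge0 _))) ?normal_peak_ge0 //.
have -> : expR (- (u ^+ 2 / 4)) = expR (u ^+ 2 / 4) * expR (- (u ^+ 2 / 2)).
  by rewrite -expRD; congr expR; field.
rewrite (mulrACA C) ler_pM ?mulr_ge0 ?expR_ge0 ?normal_peak_ge0 //.
Qed.

(** The mean value theorem evaluates the next derivative within distance 1 of [u]; passing to the
    wider density of standard deviation 2 pays for this displacement. The second bound needs
    [0 < k], as the cdf itself tends to 1 at infinity. *)
Lemma normal_cdf_derive_envelope k : exists2 C, 0 <= C &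
  (forall u v, `|u - v| <= 1 ->
    `|normal_cdf_derive k u - normal_cdf_derive k v| <=
       C * `|u - v| * normal_pdf 0 2 u) /\
  ((0 < k)%N -> forall u, `|normal_cdf_derive k u| <= C * normal_pdf 0 2 u).
Proof.
have p2 : 0 < normal_peak (2 : R) by rewrite normal_peak_gt0 // pnatr_eq0.
have env (C : R) u x : 0 <= C -> u ^+ 2 / 8 <= x ^+ 2 / 4 + 4^-1 ->
    C * expR (- (x ^+ 2 / 4)) <= C * expR 4^-1 / normal_peak 2 * normal_pdf 0 2 u.
  move=> C0 ux; rewrite normal_pdf02E.
  have -> : C * expR 4^-1 / normal_peak 2 * (normal_peak 2 * expR (- (u ^+ 2 / 8))) =
      C * (expR 4^-1 * expR (- (u ^+ 2 / 8))) by field; rewrite gt_eqF.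
  by rewrite ler_wpM2l // -expRD ler_expR; lra.
have [C C0 HC] := normal_cdf_derive_bound k.
have D0 : 0 <= C * expR 4^-1 / normal_peak 2.
  by rewrite divr_ge0 ?mulr_ge0 ?expR_ge0 ?normal_peak_ge0.
have part1 u v : `|u - v| <= 1 ->
    `|normal_cdf_derive k u - normal_cdf_derive k v| <=
       C * expR 4^-1 / normal_peak 2 * `|u - v| * normal_pdf 0 2 u.
  move=> uv.
  have [|s sv] := @MVT_line R R (normal_cdf_derive k) u 1 (v - u).
    by move=> y; case: (is_derive_normal_cdf_derive k y).
  rewrite [_ *: (1 : R)]mulr1 subrK => E.
  case: (is_derive_normal_cdf_derive k (s *: (1 : R) + u)) => _ D.
  rewrite {}D in E; rewrite distrC E normrM distrC mulrAC mulrC ler_wpM2r //.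
  apply: le_trans (HC _) (env _ _ _ C0 _).
  rewrite [_ *: (1 : R)]mulr1.
  rewrite distrC in uv; have /ler_normlP[s1 s2] := le_trans sv uv.
  (* Completing the square: [u ^+ 2 / 8 <= (s + u) ^+ 2 / 4 + 4^-1] follows from this square being
     nonnegative and [s ^+ 2 <= 1]. *)
  have := sqr_ge0 (2 * s + u); nra.
case: k HC D0 part1 => [|k] HC D0 part1.
  by exists (C * expR 4^-1 / normal_peak 2).
have [C' C'0 HC'] := normal_cdf_derive_bound k.
have D'0 : 0 <= C' * expR 4^-1 / normal_peak 2.
  by rewrite divr_ge0 ?mulr_ge0 ?expR_ge0 ?normal_peak_ge0.
exists (C * expR 4^-1 / normal_peak 2 + C' * expR 4^-1 / normal_peak 2).
  exact: addr_ge0.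
split=> [u v uv|_ u].
  rewrite (le_trans (part1 _ _ uv)) // ler_wpM2r ?normal_pdf_ge0 //.
  by rewrite ler_wpM2r // lerDl.
apply: le_trans (HC' _) (le_trans (env _ u u C'0 _) _).
  by have := sqr_ge0 u; lra.
by rewrite ler_wpM2r ?normal_pdf_ge0 // lerDr.
Qed.

Lemma normal_cdf_derive_envelopes n : exists2 C, 0 <= C & forall k, (k <= n)%N ->
  (forall u v, `|u - v| <= 1 ->
    `|normal_cdf_derive k u - normal_cdf_derive k v| <=
       C * `|u - v| * normal_pdf 0 2 u) /\
  ((0 < k)%N -> forall u, `|normal_cdf_derive k u| <= C * normal_pdf 0 2 u).
Proof.
elim: n => [|n [C C0 HC]].
  have [C C0 HC] := normal_cdf_derive_envelope 0; exists C => // k.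
  by rewrite leqn0 => /eqP ->.
have [D D0 [HD1 HD2]] := normal_cdf_derive_envelope n.+1.
exists (C + D); first exact: addr_ge0.
move=> k; rewrite leq_eqVlt => /orP[/eqP ->|/HC[HC1 HC2]].
  split=> [u v uv|_ u].
    rewrite (le_trans (HD1 _ _ uv)) // ler_wpM2r ?normal_pdf_ge0 //.
    by rewrite ler_wpM2r // lerDr.
  by rewrite (le_trans (HD2 isT _)) // ler_wpM2r ?normal_pdf_ge0 // lerDr.
split=> [u v uv|k0 u].
  rewrite (le_trans (HC1 _ _ uv)) // ler_wpM2r ?normal_pdf_ge0 //.
  by rewrite ler_wpM2r // lerDl.
by rewrite (le_trans (HC2 k0 _)) // ler_wpM2r ?normal_pdf_ge0 // lerDl.
Qed.

End gaussian_cdf.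

(** * Location kernels and samples of the regression model *)

Section location_kernel.
Context {R : realType} {dX : measure_display} {T : measurableType dX}.
Implicit Types (a : R) (f : {mfun T >-> R}).

Local Notation N := (normal_prob (0 : R) 1).

Local Notation mR := (measurableTypeR R).

Definition shiftf a : mR -> R := fun e => a + e.

Lemma measurable_shiftf a : measurable_fun setT (shiftf a).
Proof. exact: measurable_funD. Qed.

HB.instance Definition _ a := isMeasurableFun.Build _ _ _ _ (shiftf a)
  (measurable_shiftf a).

Definition location_map f (p : T * mR) : T * R := (p.1, f p.1 + p.2).

Lemma measurable_location_map f : measurable_fun setT (location_map f).
Proof.
apply: measurable_fun_pair => //=.
by apply: measurable_funD => //; exact: measurableT_comp.
Qed.

Definition location_kernel f (x : T) : {measure set R -> \bar R} :=
  distribution N (shiftf (f x)).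

Lemma measurable_location_kernel f (U : set R) : measurable U ->
  measurable_fun setT (location_kernel f ^~ U).
Proof.
move=> mU.
have mA : measurable ((fun p : T * mR => f p.1 + p.2 : R) @^-1` U).
  rewrite -[_ @^-1` _]setTI.
  have : measurable_fun setT (fun p : T * mR => f p.1 + p.2 : R).
    by apply: measurable_funD => //; exact: measurableT_comp.
  exact.
have := measurable_fun_xsection N mA; congr (measurable_fun _ _).
by apply/funext => x /=; rewrite xsectionE.
Qed.

HB.instance Definition _ f := isKernel.Build _ _ _ _ R (location_kernel f)
  (measurable_location_kernel f).

Lemma prob_location_kernel f x : location_kernel f x setT = 1%E.
Proof. exact: (probability_setT (distribution N (shiftf (f x)))). Qed.

HB.instance Definition _ f := Kernel_isProbability.Build _ _ _ _ R (location_kernel f)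
  (prob_location_kernel f).

(** The joint law is the image of [P \x N] under [location_map]: both measures integrate the normal
    mass of the same sections. *)
Lemma integral_joint_law_location (P : probability T R) f (h : T * R -> \bar R) :
  measurable_fun setT h -> (forall z, 0 <= h z)%E ->
  (\int[joint_law P (location_kernel f)]_z h z =
   \int[(P \x N)%E]_z h (location_map f z))%E.
Proof.
move=> mh h0.
by rewrite -[RHS](ge0_integral_pushforward (measurable_location_map f) _ measurableT mh).
Qed.

End location_kernel.

Section reduction.
Context {R : realType} {d : nat}.
Local Notation V := 'rV[R]_d.
Local Notation N := (normal_prob (0 : R) 1).
Implicit Types (f : {mfun V >-> R}).

Lemma measurable_reg_sample n f : measurable_fun setT (@reg_sample R d n f).
Proof.
apply/measurable_fun_tnthP => i.
rewrite (_ : _ \o _ = location_map f \o (@tnth n _)^~ i).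
  apply: measurableT_comp; first exact: measurable_location_map.
  exact: measurable_tnth.
by apply/funext => s /=; rewrite /reg_sample tnth_map.
Qed.

Lemma reg_sample_cons n f p (s : n.-tuple (V * R)) :
  reg_sample f (tuple_cons (p, s)) = tuple_cons (location_map f p, reg_sample f s).
Proof. exact/val_inj. Qed.

Lemma integral_iid_law_cons {dT} (T : measurableType dT) (Q : probability T R) n
    (h : n.+1.-tuple T -> \bar R) :
  measurable_fun setT h -> (forall s, 0 <= h s)%E ->
  (\int[iid_law Q n.+1]_s h s =
   \int[Q]_p \int[iid_law Q n]_s h (tuple_cons (p, s)))%E.
Proof.
move=> mh h0; rewrite [LHS]ge0_integral_distribution //.
have mc : measurable_fun setT (h \o @tuple_cons _ T n).
  exact: measurableT_comp mh (@measurable_tuple_cons _ T n).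
rewrite (fubini_tonelli1 (h \o @tuple_cons _ T n) mc) //.
by move=> z; exact: h0.
Qed.

(** Regression data have the law of a sample from the location kernel; the change of variables is
    made one observation at a time, by Tonelli. *)
Lemma integral_iid_location (P : probability V R) f n
    (h : n.-tuple (V * R) -> \bar R) :
  measurable_fun setT h -> (forall s, 0 <= h s)%E ->
  (\int[iid_law (joint_law P (location_kernel f)) n]_s h s =
   \int[iid_law (P \x N)%E n]_s h (reg_sample f s))%E.
Proof.
elim: n h => [|n IH] h mh h0.
  rewrite !integral_dirac //; last first.
    by apply: measurableT_comp => //; exact: measurable_reg_sample.
  by congr (_ * h _)%E; exact/val_inj.
rewrite !integral_iid_law_cons //; last first.
  exact: measurableT_comp mh (measurable_reg_sample f).
have mc : measurable_fun setT (h \o @tuple_cons _ (V * R)%type n).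
  exact: measurableT_comp mh (@measurable_tuple_cons _ _ n).
rewrite integral_joint_law_location.
- apply: eq_integral => p _; rewrite IH => [|//|//].
    by apply: eq_integral => s _; rewrite reg_sample_cons.
  have mp := measurable_fun_pair2 (location_map f p) mc.
  exact: mp.
- have mF := measurable_fun_fubini_tonelli_F
    (m2 := iid_law (joint_law P (location_kernel f)) n) _ mc.
  exact: (mF (fun z => h0 _)).
- by move=> p; apply: integral_ge0.
Qed.

End reduction.

(** * From conditional cdfs to regression functions *)

Section normal_cdf_integral.
Context {R : realType}.
Local Notation N := (normal_prob (0 : R) 1).
Local Notation mu := (@lebesgue_measure R).
Local Notation mR := (measurableTypeR R).
Implicit Types (a t : R) (g : R -> R).

Lemma normal_cdf_derive_continuous k : continuous (@normal_cdf_derive R k).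
Proof.
move=> u; apply/differentiable_continuous/derivable1_diffP.
by case: (is_derive_normal_cdf_derive k u).
Qed.

Lemma measurable_normal_cdf_derive k :
  measurable_fun (setT : set R) (@normal_cdf_derive R k).
Proof.
apply: continuous_measurable_fun.
exact: normal_cdf_derive_continuous.
Qed.

Lemma measurable_normal_cdf : measurable_fun (setT : set R) (@normal_cdf R).
Proof. exact: (measurable_normal_cdf_derive 0). Qed.

Lemma normal_cdfB s t : s <= t ->
  (normal_cdf t - normal_cdf s)%:E = N `]s, t]%classic.
Proof.
move=> st.
have fN (A : set mR) : measurable A -> N A \is a fin_num.
  by move=> mA; rewrite fin_num_measure.
have E : `]-oo, t]%classic = (`]-oo, s] `|` `]s, t])%classic.
  by rewrite -itv_bndbnd_setU.
have : N `]-oo, t]%classic = (N `]-oo, s]%classic + N `]s, t]%classic)%E.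
  rewrite E measureU //; apply/seteqP; split => // x /=.
  rewrite !in_itv /= => -[xs /andP[sx _]].
  by have := le_lt_trans xs sx; rewrite ltxx.
rewrite /normal_cdf => ->; rewrite fineD ?fN // addrAC subrr add0r fineK ?fN //.
Qed.

(** Tonelli on the strip [t - b < e <= t - a]: its sections at fixed [t] have normal mass equal to
    the integrand, those at fixed [e] are intervals of length [b - a]. *)
Lemma integral_normal_cdf_shift a b : a <= b ->
  (\int[mu]_t (normal_cdf (t - a) - normal_cdf (t - b))%:E = (b - a)%:E)%E.
Proof.
move=> ab; pose h (p : mR * mR) : bool := (p.1 - b < p.2) && (p.2 <= p.1 - a).
have mh : measurable_fun setT h.
  apply: measurable_and; [apply: measurable_fun_ltr|apply: measurable_fun_ler] => //.
    exact: measurable_funB.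
  exact: measurable_funB.
pose A : set (mR * mR) := [set p | h p].
have mA : measurable A.
  have := mh measurableT [set true] I; rewrite setTI.
  by congr measurable; apply/seteqP; split => p /=.
have mF : measurable_fun setT (fun p => (\1_A p)%:E : \bar R).
  by apply/measurable_EFinP; exact: measurable_indic.
have F0 p : (0 <= (\1_A p)%:E :> \bar R)%E by rewrite lee_fin.
transitivity (\int[mu]_t \int[N]_e (\1_A (t, e))%:E)%E.
  apply: eq_integral => t _; rewrite normal_cdfB ?lerB //.
  by rewrite -[`]_, _]%classic]setIT -integral_indic.
rewrite (fubini_tonelli (m1 := mu) (m2 := N) _ mF F0).
transitivity (\int[N]_e (b - a)%:E)%E; last first.
  rewrite integral_cst // -[RHS]mule1; congr (_ * _)%E.
  exact: (probability_setT (normal_prob (0 : R) 1)).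
apply: eq_integral => e _; have -> : (b - a)%:E = mu `[e + a, e + b[%classic.
  rewrite lebesgue_measure_itv /= lte_fin ltrD2l; case: ltP => [_|ba].
    by rewrite -EFinD; congr EFin; ring.
  by congr EFin; apply/eqP; rewrite subr_eq0 eq_le ab ba.
rewrite -[`[_, _[%classic]setIT -integral_indic //; apply: eq_integral => t _.
rewrite !indicE; congr ((nat_of_bool _)%:R%:E).
apply/idP/idP; rewrite !inE /A /h /= in_itv /= => /andP[? ?]; apply/andP; split; lra.
Qed.

Lemma normal_cdf_le s t : s <= t -> normal_cdf s <= normal_cdf t.
Proof. by move=> st; rewrite -subr_ge0 -lee_fin normal_cdfB // measure_ge0. Qed.

Lemma measurable_normal_cdf_shift a :
  measurable_fun (setT : set R) (fun t => normal_cdf (t - a)).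
Proof.
by apply: (measurableT_comp measurable_normal_cdf); exact: measurable_funB.
Qed.

Lemma normal_cdf_shift_integrable a b :
  mu.-integrable setT (fun t => (normal_cdf (t - a) - normal_cdf (t - b))%:E) /\
  (\int[mu]_t (normal_cdf (t - a) - normal_cdf (t - b))%:E = (b - a)%:E)%E.
Proof.
have key r s : r <= s ->
    mu.-integrable setT (fun t => (normal_cdf (t - r) - normal_cdf (t - s))%:E).
  move=> rs; apply/integrableP; split.
    apply/measurable_EFinP; apply: measurable_funB; exact: measurable_normal_cdf_shift.
  apply: (@le_lt_trans _ _ (s - r)%:E); last exact: ltry.
  rewrite -integral_normal_cdf_shift // le_eqVlt; apply/orP; left; apply/eqP.
  apply: eq_integral => t _.
  by rewrite gee0_abs // lee_fin subr_ge0 normal_cdf_le // lerB.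
have [ab|/ltW ba] := leP a b.
  by split; [exact: key|exact: integral_normal_cdf_shift].
have [ib eb] := (key _ _ ba, integral_normal_cdf_shift ba).
have E : (fun t => (normal_cdf (t - a) - normal_cdf (t - b))%:E) =
    (fun t => - (normal_cdf (t - b) - normal_cdf (t - a))%:E)%E.
  by apply/funext => t; rewrite -EFinN opprB.
rewrite E; split; first exact: integrableN.
rewrite integralN.
  by rewrite eb -EFinN opprB.
exact: integrable_add_def.
Qed.

End normal_cdf_integral.

Section estimator.
Context {R : realType}.
Local Notation mu := (@lebesgue_measure R).
Local Notation mR := (measurableTypeR R).

(** If the right-hand side is finite, [a] can be written as the integral of
    [normal_cdf t - normal_cdf (t - a)] and subtracted under the integral sign; otherwise there is
    nothing to prove. *)
Lemma Rintegral_normal_cdf_sub_dist (g : R -> R) (a : R) :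
  measurable_fun (setT : set R) g ->
  (`|\int[mu]_t (normal_cdf t - g t)%R - a|%:E <=
   \int[mu]_t (`|normal_cdf (t - a) - g t|)%:E)%E.
Proof.
move=> mg; have [inf|fin] := leP +oo%E (\int[mu]_t (`|normal_cdf (t - a) - g t|)%:E)%E.
  by apply: le_trans inf; exact: leey.
have mD : measurable_fun (setT : set R) (fun t => normal_cdf (t - a) - g t).
  by apply: measurable_funB => //; exact: measurable_normal_cdf_shift.
have iD : mu.-integrable setT (EFin \o fun t => normal_cdf (t - a) - g t).
  by apply/integrableP; split; [exact/measurable_EFinP|].
have [i0 e0] := @normal_cdf_shift_integrable R 0 a.
have -> : (\int[mu]_t (normal_cdf t - g t) - a)%R =
    (\int[mu]_t (normal_cdf (t - a) - g t))%R.
  have -> : (\int[mu]_t (normal_cdf t - g t))%R =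
    (\int[mu]_t ((normal_cdf (t - 0) - normal_cdf (t - a)) + (normal_cdf (t - a) - g t)))%R.
    by apply: eq_Rintegral => t _; rewrite subr0; ring.
  rewrite RintegralD // {1}/Rintegral e0 subr0 /=; ring.
apply: le_trans (_ : (\int[mu]_t `|normal_cdf (t - a) - g t|)%:E <= _)%E.
  by rewrite lee_fin; exact: le_normr_Rintegral.
by rewrite /Rintegral fineK // ge0_fin_numE ?integral_ge0.
Qed.

End estimator.

Section risk_comparison.
Context {R : realType} {d : nat}.
Local Notation V := 'rV[R]_d.
Local Notation mu := (@lebesgue_measure R).
Local Notation mR := (measurableTypeR R).
Variables (PX : probability V R) (n : nat).
Local Notation sample := (n.-tuple (V * R)).

Lemma cond_cdf_location (f : {mfun V >-> R}) t x :
  cond_cdf (location_kernel f) t x = normal_cdf (t - f x).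
Proof.
rewrite /cond_cdf /normal_cdf /location_kernel /distribution /pushforward.
congr (fine (normal_prob _ _ _)); apply/seteqP.
by split => e /=; rewrite /shiftf !in_itv /= lerBrDl.
Qed.

(** Applied to the true cdf [normal_cdf (t - f x)] it returns [f x]. Where the integral is not
    finite its value defaults to 0, harmlessly, because the cdf loss is then infinite. *)
Definition mean_estimator (Fh : sample -> R -> V -> R) (s : sample) (x : V) : R :=
  \int[mu]_t (normal_cdf t - Fh s t x).

Variable Fh : sample -> R -> V -> R.
Hypothesis mFh : cdf_estimator Fh.

Lemma measurable_cdf_estimator_uncurry :
  measurable_fun setT (fun w : (sample * V) * mR => Fh w.1.1 w.2 w.1.2).
Proof.
have mF : measurable_fun setT (fun w : sample * (R * V) => Fh w.1 w.2.1 w.2.2) by [].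
apply: (measurableT_comp (f := fun w : sample * (R * V) => Fh w.1 w.2.1 w.2.2)
  (g := fun w : (sample * V) * mR => (w.1.1, (w.2 : R, w.1.2)))) => //.
apply: measurable_fun_pair; first exact: measurableT_comp.
by apply: measurable_fun_pair => //; exact: measurableT_comp.
Qed.

Lemma mean_estimator_reg_estimator : reg_estimator (mean_estimator Fh).
Proof.
rewrite /reg_estimator /mean_estimator /Rintegral /=.
apply: measurableT_comp => //.
pose D (w : (sample * V) * mR) := (normal_cdf (w.2 : R) - Fh w.1.1 w.2 w.1.2)%:E.
have mD : measurable_fun setT D.
  apply/measurable_EFinP; apply: measurable_funB.
    by apply: (measurableT_comp (measurable_normal_cdf)).
  exact: measurable_cdf_estimator_uncurry.
(* Tonelli makes the integrals of the positive and negative parts measurable in [w]. *)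
rewrite (_ : (fun w => _) = (fun w : sample * V =>
    \int[mu]_t (D^\+ (w, t))%E - \int[mu]_t (D^\- (w, t)))%E); last first.
  apply/funext => w; rewrite integralE; congr (_ - _)%E; apply: eq_integral => t _.
    by rewrite !funeposE.
  by rewrite !funenegE.
apply: emeasurable_funB.
  apply: (measurable_fun_fubini_tonelli_F (m2 := mu)) => //.
  exact: measurable_funepos.
apply: (measurable_fun_fubini_tonelli_F (m2 := mu)) => //.
exact: measurable_funeneg.
Qed.

(** After the change of variables both risks are integrals over the same noise and design, and the
    integrands compare pointwise. *)
Lemma reg_risk_mean_estimator_le (f : {mfun V >-> R}) :
  (reg_risk PX 1 (mean_estimator Fh) f <= cdf_risk PX Fh (location_kernel f))%E.
Proof.
pose G (w : sample * V) := (\int[mu]_t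
  (`|normal_cdf (t - f w.2) - Fh w.1 t w.2|)%:E)%E.
have G0 w : (0 <= G w)%E by apply: integral_ge0 => t _; rewrite lee_fin.
have mG : measurable_fun setT G.
  apply: (measurable_fun_fubini_tonelli_F (m2 := mu)
    (fun w : (sample * V) * mR =>
       (`|normal_cdf ((w.2 : R) - f w.1.2) - Fh w.1.1 w.2 w.1.2|)%:E)) => //.
  apply/measurable_EFinP; apply: measurableT_comp => //; apply: measurable_funB.
    apply: (measurableT_comp measurable_normal_cdf); apply: measurable_funB => //.
    by apply: measurableT_comp => //; exact: measurableT_comp.
  exact: measurable_cdf_estimator_uncurry.
have -> : cdf_risk PX Fh (location_kernel f) =
   (\int[iid_law (PX \x normal_prob (0 : R) 1) n]_s \int[PX]_x G (reg_sample f s, x))%E.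
  rewrite /cdf_risk.
  transitivity (\int[iid_law (joint_law PX (location_kernel f)) n \x PX]_w G w)%E.
    apply: eq_integral => w _; apply: eq_integral => t _.
    by rewrite cond_cdf_location.
  rewrite (fubini_tonelli1 G mG G0).
  rewrite (integral_iid_location PX f (h := fun s => \int[PX]_x G (s, x))%E) //.
    exact: (measurable_fun_fubini_tonelli_F (m2 := PX) G mG G0).
  by move=> s; apply: integral_ge0.
have mrs := measurable_reg_sample (n := n) f.
have mpair : measurable_fun setT
    (fun w : n.-tuple (V * mR) * V => (reg_sample f w.1 : sample, w.2)).
  apply: measurable_fun_pair => //.
  exact: (measurableT_comp mrs measurable_fst).
pose H (w : n.-tuple (V * mR) * V) :=
  (`|mean_estimator Fh (reg_sample f w.1) w.2 - f w.2|)%:E.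
have mH : measurable_fun setT H.
  apply/measurable_EFinP; apply: measurableT_comp => //; apply: measurable_funB.
    have mm : measurable_fun setT (fun w : sample * V => mean_estimator Fh w.1 w.2)
      := mean_estimator_reg_estimator.
    exact: (measurableT_comp mm mpair).
  by apply: measurableT_comp.
have H0 w : (0 <= H w)%E by rewrite lee_fin.
have mGr : measurable_fun setT (fun w : n.-tuple (V * mR) * V =>
    G (reg_sample f w.1, w.2)) by exact: (measurableT_comp mG mpair).
rewrite /reg_risk; apply: ge0_le_integral => //.
- by move=> s _; apply: integral_ge0 => x _; exact: (H0 (s, x)).
- exact: (measurable_fun_fubini_tonelli_F (m2 := PX) H mH H0).
- exact: (measurable_fun_fubini_tonelli_F (m2 := PX) _ mGr (fun w => G0 _)).
move=> s _; apply: ge0_le_integral => //.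
- exact: (measurable_fun_pair2 s mH).
- exact: (measurable_fun_pair2 s mGr).
move=> x _; apply: Rintegral_normal_cdf_sub_dist.
exact: (measurable_fun_pair2 (reg_sample f s, x) measurable_cdf_estimator_uncurry).
Qed.

End risk_comparison.

(** * The location family belongs to the smoothness class *)

Section location_family.
Context {R : realType} {d : nat}.
Local Notation V := 'rV[R]_d.
Local Notation mu := (@lebesgue_measure R).
Local Notation mR := (measurableTypeR R).
Local Notation term := (partition_term (d := d)).

Lemma continuous_measurable_rV (f : V -> R) : continuous f -> measurable_fun setT f.
Proof.
move=> /continuousP cf; apply: (measurability _ (RGenOpens.measurableE R)).
move=> _ [_ [a [b ->] <-]]; rewrite setTI; apply: sub_sigma_algebra.
by apply: cf; exact: interval_open.
Qed.

Lemma joint_law_location_atomless (PX : probability V R) (f : {mfun V >-> R}) t :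
  joint_law PX (location_kernel f) ([set: V] `*` [set t]) = 0%E.
Proof.
apply: integral0_eq => x _.
have -> : xsection ([set: V] `*` [set t]) x = [set t].
  by rewrite xsectionE; apply/seteqP; split => y /=; [case|].
suff : normal_prob (0 : R) 1 (shiftf (f x) @^-1` [set t]) = 0%E by [].
have -> : shiftf (f x) @^-1` [set t] = [set t - f x].
  apply/seteqP; split => e; rewrite /shiftf /=; first by move=> <-; ring.
  by move=> ->; ring.
exact: integral_set1.
Qed.

Lemma integral_normal_pdf_shift (s a : R) :
  s != 0 -> (\int[mu]_t (normal_pdf 0 s (t - a))%:E = 1)%E.
Proof.
move=> s0; rewrite -(integral_normal_pdf a s); apply: eq_integral => t _.
by rewrite !normal_pdfE // /normal_fun subr0.
Qed.

Variables (L beta : R) (f : V -> R).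
Hypotheses (hd : (0 < d)%N) (hbeta : 0 < beta) (Hf : hoelder_class L beta f).
Hypothesis L_small : d%:R * (3 * L) <= 1.
Local Notation N := (smooth_int beta).
Local Notation g := (smooth_frac beta).

Variable C : R.
Hypothesis C_ge0 : 0 <= C.
Hypothesis HC : forall k, (k <= N)%N ->
  (forall u v, `|u - v| <= 1 ->
    `|normal_cdf_derive k u - normal_cdf_derive k v| <=
       C * `|u - v| * normal_pdf 0 2 u) /\
  ((0 < k)%N -> forall u, `|normal_cdf_derive k u| <= C * normal_pdf 0 2 u).

(** With [e] the common modulus of the derivatives of [f], the product of blocks contributes
    [size l] times [e] and the outer factor one more [e]. By [L_small], block factors are at most 1
    and [e <= 1], as the envelope bound requires. *)
Lemma partition_term_dist w l t x y : sorted le_ord w -> size w = N ->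
  l \in word_partitions w -> unit_cube x -> unit_cube y ->
  `|term f (@normal_cdf_derive R) l t x - term f (@normal_cdf_derive R) l t y| <=
  C * N.+1%:R * (d%:R * (3 * L) * `|x - y| `^ g) * normal_pdf 0 2 (t - f x).
Proof.
move=> sw wN lw cx cy; have [lN lB] := word_partitions_blocks lw.
rewrite wN in lN; have L0 := hoelder_const_ge0 hd Hf.
set e := d%:R * (3 * L) * _.
have e0 : 0 <= e by rewrite !mulr_ge0 ?powR_ge0.
have g0 := smooth_frac_gt0 hbeta.
have e1 : e <= 1.
  rewrite mulr_ile1 ?mulr_ge0 ?powR_ge0 //.
  have := @ge0_ler_powR _ g (ltW g0) `|x - y| 1.
  by rewrite !nnegrE normr_ge0 ler01 powR1; apply => //; exact: unit_cube_dist.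
(* A nonempty block forces [0 < N], without which the class imposes no sup bound. *)
have blk B : B \in l -> [/\ sorted le_ord B, (size B <= N)%N & (0 < N)%N].
  move=> /lB[Bw B0]; have BN : (size B <= N)%N by rewrite -wN size_subseq.
  split=> //; last exact: leq_trans BN.
  by apply: subseq_sorted Bw sw; exact: le_ord_trans.
have L31 : 3 * L <= 1.
  by apply: le_trans L_small; rewrite ler_peMl ?mulr_ge0 // ler1n.
have [Q1 PQ] : `|block_product f l y| <= 1 /\
    `|block_product f l x - block_product f l y| <= (size l)%:R * e.
  apply: prod_seq_dist => B /blk[sB BN N0]; split.
  - by rewrite (le_trans (partial_word_le3 hd hbeta Hf _ sB BN N0)).
  - by rewrite (le_trans (partial_word_le3 hd hbeta Hf _ sB BN N0)).
  - exact: partial_word_cube_hoelder.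
have fxy : `|f x - f y| <= e.
  exact: (@partial_word_cube_hoelder _ _ _ _ _ hd hbeta Hf [::]).
have [HC1 HC2] := HC lN.
have dphi := HC1 (t - f x) (t - f y).
rewrite (_ : t - f x - (t - f y) = - (f x - f y)) ?normrN in dphi; last by ring.
have {}dphi := dphi (le_trans fxy e1).
rewrite /partition_term; set c := (-1) ^+ _; have c1 : `|c| = 1.
  by rewrite normrX normrN1 expr1n.
set p := normal_cdf_derive _ (t - f x) in dphi *.
set p' := normal_cdf_derive _ (t - f y) in dphi *.
set P := block_product f l x in PQ *; set Q := block_product f l y in Q1 PQ *.
have -> : c * p * P - c * p' * Q = c * (p * (P - Q) + (p - p') * Q) by ring.
rewrite normrM c1 mul1r (le_trans (ler_normD _ _)) // !normrM.
set E := normal_pdf 0 2 _ in dphi *; have E0 : 0 <= E by exact: normal_pdf_ge0.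
apply: le_trans (_ : C * E * ((size l)%:R * e) + C * e * E * 1 <= _).
  rewrite lerD //.
    (* Without blocks the outer factor is the cdf, which has no integrable envelope; but then both
       products are empty and their difference vanishes. *)
    case: (posnP (size l)) => [l0|l0]; last by rewrite ler_pM // HC2.
    rewrite l0 mul0r normr_le0 in PQ; rewrite (eqP PQ) normr0 mulr0.
    by rewrite !mulr_ge0.
  rewrite ler_pM // (le_trans dphi) // ler_wpM2r // ler_wpM2l //.
rewrite (_ : _ + _ = C * (size l).+1%:R * e * E); last by rewrite -natr1; ring.
by rewrite !ler_wpM2r // ler_wpM2l // ler_nat.
Qed.

End location_family.

(** The maximum makes the number of Faa di Bruno terms, a Bell number, uniform over words of length
    [n], so that [L] can be chosen before the multi-index. *)
Definition max_word_partitions (d n : nat) : nat :=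
  \max_(w : n.-tuple 'I_d) size (word_partitions w).

Lemma location_kernel_cdf_class {R : realType} {d : nat} (L K beta C : R)
    (PX : probability 'rV[R]_d R) (f : {mfun 'rV[R]_d >-> R}) :
  (0 < d)%N -> 0 < beta -> hoelder_class L beta f -> d%:R * (3 * L) <= 1 ->
  0 <= C ->
  (forall k, (k <= smooth_int beta)%N ->
    (forall u v, `|u - v| <= 1 ->
      `|normal_cdf_derive k u - normal_cdf_derive k v| <=
         C * `|u - v| * normal_pdf 0 2 u) /\
    ((0 < k)%N -> forall u, `|normal_cdf_derive k u| <= C * normal_pdf 0 2 u)) ->
  (max_word_partitions d (smooth_int beta))%:R * (C * (smooth_int beta).+1%:R) *
    (d%:R * (3 * L)) <= K ->
  cdf_class PX K beta (location_kernel f).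
Proof.
move=> hd hbeta Hf Ls C0 HC LK.
have hf w : sorted le_ord w -> (size w <= smooth_int beta)%N -> has_partial_word w f.
  exact: has_sorted_partial Hf _.
have cdfE t : cond_cdf (location_kernel f) t = fun x => normal_cdf_derive 0 (t - f x).
  by apply/funext => x; rewrite cond_cdf_location.
have sum w t := partial_word_location hf (@is_derive_normal_cdf_derive R) t (w := w).
split.
- exact: joint_law_location_atomless.
- move=> t a aN; rewrite cdfE.
  by have [] := sum (mi_word a) t (mi_word_sorted a); rewrite ?size_mi_word.
move=> a aN x y cx cy; set g := smooth_frac beta.
set w := mi_word a; have sw : sorted le_ord w := mi_word_sorted a.
have wN : size w = smooth_int beta by rewrite size_mi_word.
pose T := partition_term f (@normal_cdf_derive R).
have pE t z : mi_partial a (cond_cdf (location_kernel f) t) z =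
    \sum_(l <- word_partitions w) T l t z.
  by rewrite cdfE /mi_partial; have [|_ ->] := sum w t sw; rewrite ?wN.
have L0 := hoelder_const_ge0 hd Hf.
pose e := d%:R * (3 * L) * `|x - y| `^ g.
have e0 : 0 <= e by rewrite !mulr_ge0 ?powR_ge0.
pose D := (size (word_partitions w))%:R * (C * (smooth_int beta).+1%:R * e).
have D0 : 0 <= D by rewrite !mulr_ge0.
have bound t : `|mi_partial a (cond_cdf (location_kernel f) t) x -
    mi_partial a (cond_cdf (location_kernel f) t) y| <= D * normal_pdf 0 2 (t - f x).
  rewrite !pE -sumrB (le_trans (ler_norm_sum _ _ _)) //.
  have -> : D * normal_pdf 0 2 (t - f x) = \sum_(l <- word_partitions w)
      C * (smooth_int beta).+1%:R * e * normal_pdf 0 2 (t - f x).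
    by rewrite big_const_seq count_predT iter_addr_0 -[RHS]mulr_natl /D !mulrA.
  rewrite big_seq [leRHS]big_seq; apply: ler_sum => l lw.
  exact: (partition_term_dist hd hbeta Hf Ls C0 HC t sw wN lw cx cy).
have mT z : measurable_fun (setT : set R)
    (fun t => mi_partial a (cond_cdf (location_kernel f) t) z).
  rewrite (_ : (fun t => _) = fun t => \sum_(l <- word_partitions w) T l t z); last first.
    by apply/funext => t; rewrite pE.
  apply: measurable_sum => l; apply: measurable_funM => //.
  apply: measurable_funM => //.
  apply: (measurableT_comp (measurable_normal_cdf_derive _)).
  exact: measurable_funB.
have mE : measurable_fun (setT : set R) (fun t => (normal_pdf 0 2 (t - f x))%:E).
  apply/measurable_EFinP; apply: (measurableT_comp (measurable_normal_pdf 0 2)).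
  exact: measurable_funB.
(* The envelope is a translated density, of integral 1, so integrating in [t] leaves the constant
   [D]. *)
apply: (@le_trans _ _
  (\int[lebesgue_measure]_t (D%:E * (normal_pdf 0 2 (t - f x))%:E))%E).
  apply: ge0_le_integral => //.
  - apply/measurable_EFinP; apply: measurableT_comp => //.
    by apply: measurable_funB; exact: mT.
  - exact: measurable_funeM.
  - by move=> t _; rewrite -EFinM lee_fin.
rewrite ge0_integralZl //; last by move=> t _; rewrite lee_fin normal_pdf_ge0.
rewrite integral_normal_pdf_shift ?pnatr_eq0 // mule1 lee_fin.
rewrite /D /e !mulrA ler_wpM2r ?powR_ge0 // -!mulrA.
apply: le_trans LK; rewrite -!mulrA ler_wpM2r ?mulr_ge0 // ler_nat.
have := leq_bigmax (F := fun v : (smooth_int beta).-tuple 'I_d =>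
  size (word_partitions v)) (tcast wN (in_tuple w)).
by rewrite val_tcast.
Qed.

(** * Choice of the constants and comparison of the minimax risks *)

Theorem mainTheorem3 (R : realType) (d : nat) (hd : (1 <= d)%N)
    (PX : probability 'rV[R]_d R) (hPX : PX unit_cube = 1%E)
    (K beta : R) (hK : 0 < K) (hbeta : 0 < beta) :
  exists L sigma : R,
    [/\ 0 < L, 0 < sigma &
      forall n : nat, (1 <= n)%N ->
        (minimax_reg PX n L beta sigma <= minimax_cdf PX n K beta)%E].
Proof.
have [C C0 HC] := normal_cdf_derive_envelopes (R := R) (smooth_int beta).
pose A := (max_word_partitions d (smooth_int beta))%:R * (C * (smooth_int beta).+1%:R).
have A0 : 0 <= A by rewrite !mulr_ge0.
have d0 : 0 < d%:R :> R by rewrite ltr0n.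
(* [L] is chosen so that [d%:R * (3 * L)] equals [m]: the bound 1 is the smallness condition, and
   [K / (A + 1)] gives [A * m <= K] even when [A = 0]. *)
pose m := Num.min 1 (K / (A + 1)); pose L := m / (d%:R * 3).
have m0 : 0 < m by rewrite lt_min ltr01 divr_gt0 // ltr_wpDl.
have dL : d%:R * (3 * L) = m by rewrite /L; field; rewrite gt_eqF.
exists L, 1; split; [by rewrite divr_gt0 ?mulr_gt0|by []|] => n _.
apply: le_ereal_inf_tmp => _ [Fh mFh <-].
apply: (@le_trans _ _ (ereal_sup
  [set reg_risk PX 1 (mean_estimator Fh) f0 | f0 in hoelder_class L beta])).
  apply: ereal_inf_lbound; exists (mean_estimator Fh) => //.
  exact: mean_estimator_reg_estimator.
apply: ge_ereal_sup => _ [f0 Hf <-].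
have mf : measurable_fun setT f0.
  by apply: continuous_measurable_rV; exact: hoelder_continuous hd hbeta Hf.
pose mf_mixin := isMeasurableFun.Build _ _ _ _ f0 mf.
pose f : {mfun 'rV[R]_d >-> R} := HB.pack f0 mf_mixin.
apply: le_trans (reg_risk_mean_estimator_le PX mFh f) _.
apply: ereal_sup_ubound; exists (location_kernel f) => //.
apply: (location_kernel_cdf_class (L := L) (C := C)) => //.
  by rewrite dL ge_min lexx.
rewrite dL -/A; apply: le_trans (_ : A * (K / (A + 1)) <= _).
  by rewrite ler_wpM2l // ge_min lexx orbT.
rewrite mulrCA ler_piMr ?(ltW hK) // ler_pdivrMr ?mul1r ?lerDl //.
by rewrite ltr_wpDl.
Qed.
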